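(* Let $M_1$ be the Turing machine with states $A,B,C$ (plus the halting state $H$), symbols $0,1,2$ ($0$ blank) and transition table $\delta(A,0)=(1,R,B)$, $\delta(A,1)=(2,L,A)$, $\delta(A,2)=(1,L,C)$; $\delta(B,0)=(0,L,A)$, $\delta(B,1)=(2,R,B)$, $\delta(B,2)=(1,L,B)$; $\delta(C,0)=(1,R,H)$, $\delta(C,1)=(1,R,A)$, $\delta(C,2)=(1,R,C)$. For $n\ge 0$ let $C(n) = {}^\omega 0\,(A0)\,2^n\,0^\omega$. Then (a) ${}^\omega 0(A0)0^\omega \vdash(3)\ C(1)$, and, for all integers $k \ge 0$: (b) $C(8k+1) \vdash(112k^2+116k+13)\ C(14k+3)$; (c) $C(8k+2) \vdash(112k^2+144k+38)\ C(14k+7)$; (d) $C(8k+3) \vdash(112k^2+172k+54)\ C(14k+8)$; (e) $C(8k+4) \vdash(112k^2+200k+74)\ C(14k+9)$; (f) $C(8k+5) \vdash(112k^2+228k+97)\ {}^\omega 0\,1\,(H1)\,2^{14k+9}\,0^\omega$; (g) $C(8k+6) \vdash(112k^2+256k+139)\ C(14k+14)$; (h) $C(8k+7) \vdash(112k^2+284k+169)\ C(14k+15)$; (i) $C(8k+8) \vdash(112k^2+312k+203)\ C(14k+16)$.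
   Context: Turing machines here have one tape, infinite in both directions, initially all blank except as specified. $\delta(q,a)=(b,D,q')$ means: in state $q$ reading symbol $a$, the machine writes $b$ on the current cell, moves the head one cell left ($D=L$) or right ($D=R$), and enters state $q'$. When the machine enters the halting state $H$ it stops. A configuration is written ${}^\omega 0\, x\,(S a)\, y\, 0^\omega$, where $x,y$ are finite words: the tape contains the word $xay$ surrounded on both sides by infinitely many $0$'s, the machine is in state $S$, and the head scans the cell containing the displayed symbol $a$. Each digit is one tape symbol; $w^n$ denotes the concatenation of $n$ copies of the word $w$ (an exponent applies to the single preceding symbol unless parentheses are used), $w^0$ is empty. $C_1 \vdash(t)\ C_2$ means that the machine, started in configuration $C_1$, is in configuration $C_2$ after exactly $t$ steps. *)

(* Defs.v *)
From Stdlib Require Import ZArith List.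
Import ListNotations.

Inductive dir := L | R.

(* [delta q a = None] means that [q] is halting on [a]. *)
Record machine (Q S : Type) := Machine {
  blank : S;
  delta : Q -> S -> option (S * dir * Q)
}.
Arguments Machine {Q S}.
Arguments blank {Q S}.
Arguments delta {Q S}.

Record config (Q S : Type) := Config {
  state : Q;
  head : Z;
  tape : Z -> S
}.
Arguments Config {Q S}.
Arguments state {Q S}.
Arguments head {Q S}.
Arguments tape {Q S}.

Definition move (D : dir) (p : Z) : Z :=
  match D with L => (p - 1)%Z | R => (p + 1)%Z end.

Definition write {S : Type} (f : Z -> S) (p : Z) (b : S) : Z -> S :=
  fun z => if (z =? p)%Z then b else f z.

Definition step {Q S : Type} (M : machine Q S) (c : config Q S)
  : option (config Q S) :=
  match delta M (state c) (tape c (head c)) with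
  | Some (b, D, q) =>
      Some (Config q (move D (head c)) (write (tape c) (head c) b))
  | None => None
  end.

(* The result of exactly [t] steps; [None] if the machine halts earlier. *)
Fixpoint steps {Q S : Type} (M : machine Q S) (t : nat) (c : config Q S)
  : option (config Q S) :=
  match t with
  | 0 => Some c
  | Datatypes.S t' =>
      match step M c with
      | Some c' => steps M t' c'
      | None => None
      end
  end.

(* [Display x q a y] is the written configuration ^w0 x (q a) y 0^w.  It does
   not say where on the tape the word x a y lies. *)
Record display (Q S : Type) := Display {
  lword : list S;
  dstate : Q;
  scanned : S;
  rword : list S
}.
Arguments Display {Q S}.
Arguments lword {Q S}.
Arguments dstate {Q S}.
Arguments scanned {Q S}.
Arguments rword {Q S}.

Definition word_at {S : Type} (b : S) (w : list S) (p : Z) : Z -> S :=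
  fun z => if (z <? p)%Z then b else nth (Z.to_nat (z - p)) w b.

Definition shown_as {Q S : Type} (M : machine Q S) (c : config Q S)
  (C : display Q S) : Prop :=
  state c = dstate C /\
  exists p : Z,
    head c = (p + Z.of_nat (length (lword C)))%Z /\
    forall z : Z,
      tape c z = word_at (blank M) (lword C ++ scanned C :: rword C) p z.

Definition yields {Q S : Type} (M : machine Q S) (t : nat)
  (C1 C2 : display Q S) : Prop :=
  forall c1 : config Q S, shown_as M c1 C1 ->
    exists c2 : config Q S, steps M t c1 = Some c2 /\ shown_as M c2 C2.

Inductive M1_state := A | B | C | H.
Inductive M1_symbol := s0 | s1 | s2.

Definition M1 : machine M1_state M1_symbol := {|
  blank := s0;
  delta q a :=
    match q, a with
    | A, s0 => Some (s1, R, B)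
    | A, s1 => Some (s2, L, A)
    | A, s2 => Some (s1, L, C)
    | B, s0 => Some (s0, L, A)
    | B, s1 => Some (s2, R, B)
    | B, s2 => Some (s1, L, B)
    | C, s0 => Some (s1, R, H)
    | C, s1 => Some (s1, R, A)
    | C, s2 => Some (s1, R, C)
    | H, _ => None
    end
|}.

Definition Cfg (n : nat) : display M1_state M1_symbol :=
  Display [] A s0 (repeat s2 n).

(* Main.v *)
Require Import Defs.
From Stdlib Require Import ZArith List Lia.
Import ListNotations.

(** Started on [C(n)] with [n >= 2], the machine reaches [0 (A1) 0 1^3 2^(n-2)]
    in ten steps.  From [0 (A1) 0 1^m 2^4 w], four sweeps of [B] to the right and
    back each turn one symbol [2] into a [1], and the machine returns to
    [0 (A1) 0 1^(m+7) w] after [8m + 41] steps.  Once fewer than four symbols [2]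
    remain, a sweep runs into the blank on the right; state [A] then travels back
    to the left, two cells every eight steps, turning everything into [2]s.  The
    residue of [n] modulo 4 fixes the word met at the left end, and the parity
    of the number of cycles fixes how the two-cell steps line up with it; this
    gives the eight cases. *)

(** * Tapes as pairs of words *)

(* The part of the tape to the left of the head is listed from right to left;
   the scanned cell is the first letter of [right]. *)
Record zipper (Q S : Type) := Zip {
  left : list S;
  zstate : Q;
  right : list S
}.
Arguments Zip {Q S}.
Arguments left {Q S}.
Arguments zstate {Q S}.
Arguments right {Q S}.

Section Zippers.
Context {Q S : Type} (M : machine Q S).

(** Reading past the end of either word yields the blank, so zippers whose words differ only in
    trailing blanks represent the same configurations. *)
Definition represents (c : config Q S) (z : zipper Q S) : Prop :=
  state c = zstate z /\
  (forall i : nat, tape c (Defs.head c + Z.of_nat i)%Z = nth i (right z) (blank M)) /\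
  (forall i : nat, tape c (Defs.head c - 1 - Z.of_nat i)%Z = nth i (left z) (blank M)).

Definition zip_step (z : zipper Q S) : option (zipper Q S) :=
  match delta M (zstate z) (hd (blank M) (right z)) with
  | Some (b, R, q) => Some (Zip (b :: left z) q (tl (right z)))
  | Some (b, L, q) =>
      Some (Zip (tl (left z)) q (hd (blank M) (left z) :: b :: tl (right z)))
  | None => None
  end.

Fixpoint zip_steps (t : nat) (z : zipper Q S) : option (zipper Q S) :=
  match t with
  | 0 => Some z
  | Datatypes.S t' =>
      match zip_step z with
      | Some z' => zip_steps t' z'
      | None => None
      end
  end.

(** Speaking of configurations rather than comparing zippers allows trailing blanks to be discarded,
    as in [runs_drop_blank]. *)
Definition runs (t : nat) (z1 z2 : zipper Q S) : Prop :=
  forall c1, represents c1 z1 ->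
    exists c2, steps M t c1 = Some c2 /\ represents c2 z2.

Lemma nth_hd (l : list S) (d : S) : nth 0 l d = hd d l.
Proof. now destruct l. Qed.

Lemma nth_tl (i : nat) (l : list S) (d : S) : nth i (tl l) d = nth (Datatypes.S i) l d.
Proof. destruct l; [now destruct i | reflexivity]. Qed.

Lemma write_same (f : Z -> S) (p z : Z) (b : S) : z = p -> write f p b z = b.
Proof. intros ->; unfold write; now rewrite Z.eqb_refl. Qed.

Lemma write_other (f : Z -> S) (p z : Z) (b : S) : z <> p -> write f p b z = f z.
Proof. intros Hz; unfold write; now rewrite (proj2 (Z.eqb_neq z p) Hz). Qed.

Lemma represents_step (c : config Q S) (z z' : zipper Q S) :
  represents c z -> zip_step z = Some z' ->
  exists c', step M c = Some c' /\ represents c' z'.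
Proof.
  intros (Hq & Hr & Hl) Hz.
  assert (Hhd : tape c (Defs.head c) = hd (blank M) (right z)).
  { rewrite <- nth_hd, <- Hr; f_equal; lia. }
  unfold zip_step in Hz; unfold step; rewrite Hq, Hhd.
  destruct (delta M (zstate z) (hd (blank M) (right z))) as [[[b [|]] q]|];
    [| | discriminate]; injection Hz as <-;
    eexists; (split; [reflexivity|]); (split; [reflexivity|]); cbn; split.
  - intros [|[|i]]; cbn [nth].
    + rewrite write_other, <- nth_hd, <- Hl by lia; f_equal; lia.
    + apply write_same; lia.
    + rewrite write_other, nth_tl, <- Hr by lia; f_equal; lia.
  - intros i; rewrite write_other, nth_tl, <- Hl by lia; f_equal; lia.
  - intros i; rewrite write_other, nth_tl, <- Hr by lia; f_equal; lia.
  - intros [|i]; cbn [nth].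
    + apply write_same; lia.
    + rewrite write_other, <- Hl by lia; f_equal; lia.
Qed.

Lemma runs_zip_steps (t : nat) (z z' : zipper Q S) :
  zip_steps t z = Some z' -> runs t z z'.
Proof.
  revert z; induction t as [|t IH]; intros z Hz c Hc; cbn in Hz |- *.
  - injection Hz as <-; now exists c.
  - destruct (zip_step z) as [z1|] eqn:E; [|discriminate].
    destruct (represents_step c z z1 Hc E) as (c' & -> & Hc').
    exact (IH z1 Hz c' Hc').
Qed.

Lemma steps_add (s t : nat) (c : config Q S) :
  steps M (s + t) c =
  match steps M s c with Some c' => steps M t c' | None => None end.
Proof.
  revert c; induction s as [|s IH]; intros c; cbn; [reflexivity|].
  destruct (step M c); [apply IH | reflexivity].
Qed.

Lemma runs_trans (s t : nat) (z1 z2 z3 : zipper Q S) :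
  runs s z1 z2 -> runs t z2 z3 -> runs (s + t) z1 z3.
Proof.
  intros H12 H23 c1 Hc1.
  destruct (H12 c1 Hc1) as (c2 & E & Hc2).
  rewrite steps_add, E; exact (H23 c2 Hc2).
Qed.

Lemma runs_drop_blank (t : nat) (z : zipper Q S) (l : list S) (q : Q) (r : list S) :
  runs t z (Zip l q (r ++ [blank M])) -> runs t z (Zip l q r).
Proof.
  intros Hrun c1 Hc1; destruct (Hrun c1 Hc1) as (c2 & E & Hq & Hr & Hl).
  exists c2; split; [exact E|]; split; [exact Hq|]; split; [|exact Hl].
  intros i; rewrite Hr; cbn.
  destruct (Nat.lt_ge_cases i (length r)) as [Hi|Hi].
  - now apply app_nth1.
  - rewrite app_nth2, (nth_overflow r) by lia.
    destruct (i - length r) as [|[|j]]; reflexivity.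
Qed.

Definition zip_of (D : display Q S) : zipper Q S :=
  Zip (rev (lword D)) (dstate D) (scanned D :: rword D).

Lemma shown_as_zip_of (c : config Q S) (D : display Q S) :
  shown_as M c D <-> represents c (zip_of D).
Proof.
  destruct D as [x q a y]; unfold shown_as, represents, zip_of, word_at.
  cbn [lword dstate scanned rword left zstate right].
  split.
  - intros (Hq & p & Hp & Ht); split; [exact Hq|]; split; intros i; rewrite Ht, Hp.
    + destruct (Z.ltb_spec (p + Z.of_nat (length x) + Z.of_nat i) p); [lia|].
      rewrite app_nth2 by lia; f_equal; lia.
    + destruct (Z.ltb_spec (p + Z.of_nat (length x) - 1 - Z.of_nat i) p).
      * rewrite nth_overflow; [reflexivity|]; rewrite length_rev; lia.
      * rewrite app_nth1, rev_nth by lia; f_equal; lia.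
  - intros (Hq & Hr & Hl); split; [exact Hq|].
    exists (Defs.head c - Z.of_nat (length x))%Z; split; [lia|]; intros z.
    destruct (Z.lt_ge_cases z (Defs.head c)) as [Hz|Hz].
    + replace z with (Defs.head c - 1 - Z.of_nat (Z.to_nat (Defs.head c - 1 - z)))%Z at 1 by lia.
      rewrite Hl.
      destruct (Z.ltb_spec z (Defs.head c - Z.of_nat (length x))).
      * apply nth_overflow; rewrite length_rev; lia.
      * rewrite app_nth1, rev_nth by lia; f_equal; lia.
    + replace z with (Defs.head c + Z.of_nat (Z.to_nat (z - Defs.head c)))%Z at 1 by lia.
      rewrite Hr.
      destruct (Z.ltb_spec z (Defs.head c - Z.of_nat (length x))); [lia|].
      rewrite app_nth2 by lia; f_equal; lia.
Qed.

Lemma yields_runs (t : nat) (D1 D2 : display Q S) :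
  runs t (zip_of D1) (zip_of D2) -> yields M t D1 D2.
Proof.
  intros Hrun c1 Hc1.
  destruct (Hrun c1 (proj1 (shown_as_zip_of _ _) Hc1)) as (c2 & E & Hc2).
  exists c2; split; [exact E|]; now apply shown_as_zip_of.
Qed.

End Zippers.

(** * Sweeps of the machine *)

Notation "z1 =[ t ]=> z2" := (runs M1 t z1 z2) (at level 70, t at level 99).

Lemma runs_then (s t u : nat) (z1 z2 z3 : zipper M1_state M1_symbol) :
  z1 =[s]=> z2 -> z2 =[t]=> z3 -> u = s + t -> z1 =[u]=> z3.
Proof. intros H12 H23 ->; exact (runs_trans M1 s t z1 z2 z3 H12 H23). Qed.

Lemma repeat_cons_app {T : Type} (x : T) (n : nat) (l : list T) :
  x :: repeat x n ++ l = repeat x n ++ x :: l.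
Proof. change (x :: l) with ([x] ++ l); rewrite app_assoc, <- repeat_cons; reflexivity. Qed.

Ltac compute_run := apply runs_zip_steps; reflexivity.

Lemma sweep_right (a : nat) (l r : list M1_symbol) :
  Zip l B (repeat s1 a ++ r) =[a]=> Zip (repeat s2 a ++ l) B r.
Proof.
  revert l; induction a as [|a IH]; intros l; [compute_run|].
  apply (runs_then 1 a _ _ (Zip (s2 :: l) B (repeat s1 a ++ r)));
    [compute_run | | reflexivity].
  cbn [repeat app]; rewrite repeat_cons_app; apply IH.
Qed.

Lemma sweep_left (a : nat) (l r : list M1_symbol) :
  Zip (repeat s2 a ++ l) B (s2 :: r)
  =[a + 1]=> Zip (tl l) B (hd s0 l :: repeat s1 (a + 1) ++ r).
Proof.
  revert r; induction a as [|a IH]; intros r; [compute_run|].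
  apply (runs_then 1 (a + 1) _ _ (Zip (repeat s2 a ++ l) B (s2 :: s1 :: r)));
    [compute_run | | lia].
  replace (repeat s1 (Datatypes.S a + 1) ++ r) with (repeat s1 (a + 1) ++ s1 :: r)
    by (rewrite <- repeat_cons_app; reflexivity).
  apply IH.
Qed.

(** [B] turns the 1s into 2s, turns round at the first old 2 and makes everything 1 again. If [l] is
    empty, [hd] supplies the blank. *)
Lemma sweep_round (m : nat) (l r : list M1_symbol) :
  Zip l B (repeat s1 m ++ s2 :: r)
  =[2 * m + 1]=> Zip (tl l) B (hd s0 l :: repeat s1 (m + 1) ++ r).
Proof.
  eapply runs_then; [apply sweep_right | apply sweep_left | lia].
Qed.

Lemma sweep_round_1 (m : nat) (l r : list M1_symbol) :
  Zip (s1 :: l) B (repeat s1 m ++ s2 :: r)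
  =[2 * m + 1]=> Zip l B (repeat s1 (m + 2) ++ r).
Proof.
  replace (m + 2) with (Datatypes.S (m + 1)) by lia; apply sweep_round.
Qed.

(** Each round takes a 1 from the left word and lengthens the block by two, so the time is the sum
    of 2(m + 2i) + 1 over i < j. At j = 0 the factor [j] makes the truncated subtraction
    harmless. *)
Lemma sweep_rounds (j m : nat) (l r : list M1_symbol) :
  Zip (repeat s1 j ++ l) B (repeat s1 m ++ repeat s2 j ++ r)
  =[j * (2 * m + 2 * j - 1)]=> Zip l B (repeat s1 (m + 2 * j) ++ r).
Proof.
  revert m; induction j as [|j IH]; intros m.
  - replace (m + 2 * 0) with m by lia; compute_run.
  - replace (m + 2 * Datatypes.S j) with (m + 2 + 2 * j) by lia.
    eapply runs_then; [apply sweep_round_1 | apply IH |].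
    destruct j; nia.
Qed.

(** * The cycle and its iteration *)

Definition cycle_start (m : nat) (w : list M1_symbol) : zipper M1_state M1_symbol :=
  Zip [] A (s1 :: s0 :: repeat s1 m ++ w).

Lemma enter_cycle (w : list M1_symbol) :
  Zip [] A (s0 :: s2 :: s2 :: w) =[10]=> cycle_start 3 w.
Proof. compute_run. Qed.

Lemma cycle_open (m : nat) (w : list M1_symbol) :
  cycle_start m w =[10]=> Zip [s1; s1; s1] B (repeat s1 m ++ w).
Proof. compute_run. Qed.

Lemma cycle_once (m : nat) (w : list M1_symbol) :
  cycle_start m (repeat s2 4 ++ w) =[8 * m + 41]=> cycle_start (m + 7) w.
Proof.
  eapply runs_then; [apply cycle_open | |].
  - eapply runs_then;
      [exact (sweep_rounds 3 m [] (s2 :: w)) | | reflexivity].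
    (* The three 1s on the left are used up, so the fourth round ends on a blank; three more steps
       there restore [cycle_start]. *)
    eapply runs_then; [apply sweep_round | | reflexivity].
    replace (m + 2 * 3 + 1) with (m + 7) by lia.
    instantiate (1 := 3); compute_run.
  - lia.
Qed.

(** The block grows by 7 per cycle, so the time is the sum of 8(m + 7h) + 41 over h < i. *)
Lemma cycle_iter (i m : nat) (w : list M1_symbol) :
  cycle_start m (repeat s2 (4 * i) ++ w)
  =[i * (8 * m + 28 * i + 13)]=> cycle_start (m + 7 * i) w.
Proof.
  revert m; induction i as [|i IH]; intros m.
  - replace (m + 7 * 0) with m by lia; compute_run.
  - replace (4 * Datatypes.S i) with (4 + 4 * i) by lia.
    rewrite repeat_app, <- app_assoc.
    replace (m + 7 * Datatypes.S i) with (m + 7 + 7 * i) by lia.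
    eapply runs_then; [apply cycle_once | apply IH | nia].
Qed.

(** * The return to the left *)

Lemma turn_back (a : nat) (l : list M1_symbol) :
  Zip (repeat s2 (a + 4) ++ l) B []
  =[15]=> Zip (s1 :: repeat s2 a ++ l) A (s1 :: repeat s2 3).
Proof.
  (* The head goes one cell further to the right and leaves that cell as an explicit blank at the
     end of the word. *)
  apply runs_drop_blank.
  rewrite Nat.add_comm; compute_run.
Qed.

Lemma return_left (a s : nat) (l : list M1_symbol) :
  Zip (s1 :: repeat s2 (2 * a) ++ l) A (s1 :: repeat s2 s)
  =[8 * a]=> Zip (s1 :: l) A (s1 :: repeat s2 (s + 2 * a)).
Proof.
  revert s; induction a as [|a IH]; intros s.
  - replace (s + 2 * 0) with s by lia; compute_run.
  - replace (2 * Datatypes.S a) with (2 + 2 * a) by lia.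
    replace (s + (2 + 2 * a)) with (2 + s + 2 * a) by lia.
    eapply runs_then; [| apply IH | ].
    + instantiate (1 := 8); compute_run.
    + lia.
Qed.

(* [l] is what remains of the left word [1^3] after the last [j] rounds, and
   [e] is the parity of the number of [2]s that state [A] has to cross. *)
Lemma last_cycle (q j a e m : nat) (l : list M1_symbol) :
  [s1; s1; s1] = repeat s1 j ++ l ->
  m = 3 + 7 * q -> m + 2 * j = e + 2 * a + 4 ->
  Zip [] A (s0 :: repeat s2 (2 + (4 * q + j)))
  =[10 + (q * (28 * q + 37) +
     (10 + (j * (2 * m + 2 * j - 1) + ((m + 2 * j) + (15 + 8 * a)))))]=>
  Zip (s1 :: repeat s2 e ++ l) A (s1 :: repeat s2 (3 + 2 * a)).
Proof.
  intros Hl Hm Ha.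
  eapply runs_then; [apply (enter_cycle (repeat s2 (4 * q + j))) | | reflexivity].
  rewrite repeat_app.
  eapply runs_then; [apply cycle_iter | rewrite <- Hm | f_equal; lia].
  eapply runs_then; [apply cycle_open | rewrite Hl | reflexivity].
  rewrite <- (app_nil_r (repeat s2 j)).
  eapply runs_then; [apply sweep_rounds | | reflexivity].
  eapply runs_then; [apply sweep_right | | reflexivity].
  (* Of these 2s, [turn_back] takes four, [return_left] takes [a] pairs, and [e] remain. *)
  rewrite Ha.
  eapply runs_then; [apply turn_back | | reflexivity].
  rewrite (Nat.add_comm e), repeat_app, <- app_assoc; apply return_left.
Qed.

(** After [last_cycle], only [s] steps near the left end remain, computed outright; they bring [d]
    further 2s to the right word. *)
Ltac finish q j a e l s d :=
  eapply runs_then;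
  [ match goal with |- runs _ _ (Zip _ _ (_ :: repeat _ ?n)) _ =>
      replace n with (2 + (4 * q + j)) by lia end;
    apply (last_cycle q j a e (3 + 7 * q) l); [reflexivity | reflexivity | lia]
  | match goal with |- runs _ _ _ (Zip _ _ (_ :: repeat _ ?n)) =>
      replace n with (d + (3 + 2 * a)) by lia end;
    instantiate (1 := s); compute_run
  | rewrite ?Nat.pow_2_r; nia ].

Theorem theorem3p1 :
  yields M1 3 (Display [] A s0 []) (Cfg 1) /\
  forall k : nat,
    yields M1 (112 * k ^ 2 + 116 * k + 13) (Cfg (8 * k + 1)) (Cfg (14 * k + 3)) /\
    yields M1 (112 * k ^ 2 + 144 * k + 38) (Cfg (8 * k + 2)) (Cfg (14 * k + 7)) /\
    yields M1 (112 * k ^ 2 + 172 * k + 54) (Cfg (8 * k + 3)) (Cfg (14 * k + 8)) /\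
    yields M1 (112 * k ^ 2 + 200 * k + 74) (Cfg (8 * k + 4)) (Cfg (14 * k + 9)) /\
    yields M1 (112 * k ^ 2 + 228 * k + 97) (Cfg (8 * k + 5))
      (Display [s1] H s1 (repeat s2 (14 * k + 9))) /\
    yields M1 (112 * k ^ 2 + 256 * k + 139) (Cfg (8 * k + 6)) (Cfg (14 * k + 14)) /\
    yields M1 (112 * k ^ 2 + 284 * k + 169) (Cfg (8 * k + 7)) (Cfg (14 * k + 15)) /\
    yields M1 (112 * k ^ 2 + 312 * k + 203) (Cfg (8 * k + 8)) (Cfg (14 * k + 16)).
Proof.
  split.
  { apply yields_runs, runs_drop_blank; compute_run. }
  intros k; repeat split; apply yields_runs;
    unfold zip_of, Cfg; cbn [lword dstate scanned rword rev app].
  (* For k = 0 there is a single 2, too few for [enter_cycle]. *)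
  - destruct k as [|k]; [apply runs_drop_blank; compute_run|].
    finish (2 * k + 1) 3 (7 * k + 6) 0 (@nil M1_symbol) 2 2.
  (* For k = 0 the last sweep leaves only three 2s, one too few for [turn_back]. *)
  - destruct k as [|k]; [apply runs_drop_blank; compute_run|].
    finish (2 * k + 2) 0 (7 * k + 6) 1 [s1; s1; s1] 8 6.
  - finish (2 * k) 1 (7 * k) 1 [s1; s1] 7 5.
  - finish (2 * k) 2 (7 * k + 1) 1 [s1] 6 4.
  (* The halting case: three rounds empty [l], and with [e] = 1 state [C] meets the blank beyond the
     left end. *)
  - finish (2 * k) 3 (7 * k + 2) 1 (@nil M1_symbol) 4 2.
  - finish (2 * k + 1) 0 (7 * k + 3) 0 [s1; s1; s1] 5 5.
  - finish (2 * k + 1) 1 (7 * k + 4) 0 [s1; s1] 4 4.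
  - finish (2 * k + 1) 2 (7 * k + 5) 0 [s1] 3 3.
Qed.
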